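(* Let $\{Q_j(z)\}_{j\ge0}$ be the spectral polynomials and $\psi$ the spectral measure of a non-explosive birth and death process on $\{0,1,\ldots\}$ with rates $\lambda_i>0$ ($i\ge0$), $\mu_i>0$ ($i\ge1$), $\mu_0=0$, suppose the spectrum is discrete with support $\{\zeta_l\}_{l\ge0}$, and suppose the spectral polynomials belong to the Meixner class: there are power series $h$ and $g$ with $h(0)=1$, $g(0)=0$, $g'(0)\ne0$ such that $$\sum_{m=0}^\infty Q_m(z)\frac{v^m}{m!}=h(v)e^{zg(v)}.$$ Let $N\ge1$, $\widetilde u_j^{(l)}=Q_j(\zeta_l)$, let $\bm{Z}=(Z_1,\ldots,Z_N)$ with each $Z_k\in\{\zeta_l\}_{l\ge0}$, $|\bm{Z}|=\sum_{k=1}^NZ_k$, and $n_l=n_l(\bm{Z})=|\{k:Z_k=\zeta_l\}|$. Then for every $m\ge0$ $$\binom{N}{\bm{n}^+}^{-1}\sum_{\{\bm{x}:\sum_{j\ge1}jx_j=m\}}\binom{N}{\bm{x}}\frac{m!}{\prod_{j\ge1}(j!)^{x_j}}\,Q_{\bm{n}}(\bm{x};\widetilde{\bm{u}})=Q_m^N(|\bm{Z}|),$$ where the sum is over sequences $(x_1,x_2,\ldots)$ of non-negative integers with $\sum_{j\ge1}jx_j=m$ and $\sum_{j\ge1}x_j\le N$, $\bm{x}=(x_0,x_1,x_2,\ldots)$ with $x_0=N-\sum_{j\ge1}x_j$, and the polynomials $Q_m^N$ are defined by $$\sum_{m=0}^\infty Q_m^N(y)\frac{v^m}{m!}=h(v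)^Ne^{yg(v)}.$$
   Context: Spectral polynomials: $Q_{-1}=0$, $Q_0=1$, $-zQ_n(z)=-(\lambda_n+\mu_n)Q_n(z)+\lambda_nQ_{n+1}(z)+\mu_nQ_{n-1}(z)$ for $n\ge0$. With $\pi_0=1$, $\pi_j=\frac{\lambda_0\cdots\lambda_{j-1}}{\mu_1\cdots\mu_j}$, the spectral measure $\psi$ is the probability measure on $[0,\infty)$ such that the transition functions are $p_{ij}(t)=\pi_j\int_0^\infty e^{-zt}Q_i(z)Q_j(z)\psi(dz)$. Discrete spectrum with support $\{\zeta_l\}_{l\ge0}$ means $\psi=\sum_{l\ge0}\psi(\{\zeta_l\})\delta_{\zeta_l}$ with distinct $\zeta_l\ge0$, $\psi(\{\zeta_l\})>0$. (In the paper $Z_1,\ldots,Z_N$ are independent random variables with distribution $\psi$, and $\{Q_m^N\}$ are the orthogonal polynomials on the distribution of $|\bm{Z}|$.) $\bm{n}^+=(n_0,n_1,\ldots)$ with $\sum_{l\ge0} n_l=N$, $\binom{N}{\bm{n}^+}=N!/\prod_{l\ge0}n_l!$, $\binom{N}{\bm{x}}=N!/\prod_{j\ge0}x_j!$. $Q_{\bm{n}}(\bm{x};\widetilde{\bm{u}})$ is the coefficient of $\prod_{l\ge1}w_l^{n_l}$ in $$\prod_{j\ge0}\Big(\widetilde u_j^{(0)}+\sum_{l\ge1}w_l\widetilde u_j^{(l)}\Big)^{x_j}.$$ Equivalently, $\binom{N}{\bm{n}^+}^{-1}\binom{N}{\bm{x}}Q_{\bm{n}}(\bm{x};\widetilde{\bm{u}})$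 is the coefficient of $\prod_{j\ge0}v_j^{x_j}$ in $\prod_{k=1}^N\big(\sum_{j\ge0}Q_j(Z_k)v_j\big)$. *)

(* Defs.v *)
From HB Require Import structures.
From mathcomp Require Import all_boot all_order all_algebra finmap.
From mathcomp Require Import all_classical all_reals all_analysis.

Set Implicit Arguments.
Unset Strict Implicit.
Unset Printing Implicit Defensive.

Import Order.TTheory GRing.Theory Num.Theory.
Import numFieldNormedType.Exports.

Local Open Scope classical_set_scope.
Local Open Scope ring_scope.

(** * Birth and death processes on {0, 1, ...} *)

Section BirthDeath.
Variable R : realType.
Implicit Types (lambda mu : nat -> R) (p : R -> nat -> nat -> R).

Definition birth_death_rates lambda mu : Prop :=
  [/\ forall i, 0 < lambda i, mu 0%N = 0 & forall i, 0 < mu i.+1].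

Definition bd_generator lambda mu (i j : nat) : R :=
  if j == i.+1 then lambda i
  else if i == j.+1 then mu i
  else if i == j then - (lambda i + mu i)
  else 0.

(** Possibly dishonest: the row sums may be < 1, the missing mass being the
    probability of having left the state space. Only times t >= 0 matter. *)
Record bd_transition lambda mu p : Prop := BdTransition {
  bd_ge0 : forall t i j, 0 <= t -> 0 <= p t i j ;
  bd_sum_le1 : forall t i, 0 <= t ->
    (\sum_(0 <= j <oo) (p t i j)%:E <= 1)%E ;
  bd_init : forall i j, p 0 i j = (i == j)%:R ;
  bd_chapman_kolmogorov : forall s t i j, 0 <= s -> 0 <= t ->
    ((p (s + t) i j)%:E = \sum_(0 <= k <oo) (p s i k * p t k j)%:E)%E ;
  bd_rates : forall i j,
    (p t i j - (i == j)%:R) / t @[t --> 0^'+] --> bd_generator lambda mu i j }.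

(** The minimal transition function with given rates is that of the process
    killed at its explosion time, so the process is non-explosive exactly when
    the minimal transition function has row sums 1. *)
Definition nonexplosive_bd_transition lambda mu p : Prop :=
  [/\ bd_transition lambda mu p,
      forall p', bd_transition lambda mu p' ->
        forall t i j, 0 <= t -> p t i j <= p' t i j
    & forall t i, 0 <= t -> (\sum_(0 <= j <oo) (p t i j)%:E = 1)%E].

Definition spectral_polys lambda mu (Q : nat -> {poly R}) : Prop :=
  Q 0%N = 1 /\
  forall n, - 'X * Q n =
    - (lambda n + mu n) *: Q n + lambda n *: Q n.+1
    + mu n *: (if n is k.+1 then Q k else 0).

Definition bd_pi lambda mu (j : nat) : R :=
  \prod_(i < j) lambda i / \prod_(i < j) mu i.+1.

(** The equation is between extended reals with a finite left-hand side, so it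
    entails the integrability of the integrand. *)
Definition spectral_measure lambda mu p (Q : nat -> {poly R})
    (psi : probability (measurableTypeR R) R) : Prop :=
  psi `[0%R, +oo[%classic = 1%E /\
  forall t i j, 0 <= t ->
    ((p t i j)%:E = (bd_pi lambda mu j)%:E *
       \int[psi]_(z in `[0%R, +oo[) (expR (- z * t) * (Q i).[z] * (Q j).[z])%:E)%E.

Definition discrete_spectrum (psi : probability (measurableTypeR R) R)
    (zeta : nat -> R) : Prop :=
  [/\ injective zeta, forall l, 0 <= zeta l,
      forall l, (0 < psi [set zeta l])%E
    & forall A : set (measurableTypeR R), measurable A ->
        (psi A = \sum_(0 <= l <oo) psi [set zeta l] * \d_(zeta l) A)%E].

End BirthDeath.

(** * Formal power series in one variable v, given by their coefficients *)

Section PowerSeries.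
Variable R : realType.
Implicit Types f g h : nat -> R.

Definition ps_one : nat -> R := fun m => (m == 0%N)%:R.

Definition ps_mul f g : nat -> R :=
  fun m => \sum_(i < m.+1) f i * g (m - i)%N.

Definition ps_exp f (n : nat) : nat -> R := iter n (ps_mul f) ps_one.

(** exp (z g(v)) = \sum_k z^k g(v)^k / k! for g(0) = 0; since v^k divides
    g(v)^k, only the terms k <= m contribute to the coefficient of v^m. *)
Definition ps_expz (z : R) g : nat -> R :=
  fun m => \sum_(k < m.+1) z ^+ k / (k`!)%:R * ps_exp g k m.

(** \sum_m P_m(z) v^m / m! = h(v) exp (z g(v)) for all z. *)
Definition meixner_generated (P : nat -> {poly R}) h g : Prop :=
  forall (z : R) (m : nat), (P m).[z] / (m`!)%:R = ps_mul h (ps_expz z g) m.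

End PowerSeries.

(** * Formal power series in the variables w_0, w_1, w_2, ... *)

(** Finitely supported sequences of natural numbers. *)
Definition fsseq := {fsfun nat -> nat with 0%N}.

Section MultivariateSeries.
Variable R : realType.

(** A series is the family of its coefficients, indexed by exponents. *)
Definition wseries := fsseq -> R.
Implicit Types F G : wseries.

Definition ms_one : wseries := fun e => (e == [fsfun])%:R.

Definition ms_var (l : nat) : wseries :=
  fun e => (e == [fsfun [fsfun] with l |-> 1%N])%:R.

(** The index set of the sum is finite. *)
Definition ms_mul F G : wseries := fun e =>
  \sum_(ab \in [set ab : fsseq * fsseq | forall l, (ab.1 l + ab.2 l)%N = e l])
    F ab.1 * G ab.2.

Definition ms_exp F (n : nat) : wseries := iter n (ms_mul F) ms_one.

(** a_0 + \sum_{l >= 1} w_l a_l; for each exponent e at most one term of the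
    sum is nonzero. *)
Definition ms_linear (a : nat -> R) : wseries := fun e =>
  a 0%N * ms_one e + \sum_(l \in [set l | (1 <= l)%N]) a l * ms_var l e.

(** The coefficient of \prod_{l >= 1} w_l^{n_l} in
    \prod_j (u_j^(0) + \sum_{l >= 1} w_l u_j^(l))^{x_j}, with u j l = u_j^(l). *)
Definition krawtchouk (u : nat -> nat -> R) (n x : fsseq) : R :=
  (\big[ms_mul/ms_one]_(j <- finsupp x) ms_exp (ms_linear (u j)) (x j))
    [fsfun n with 0%N |-> 0%N].

Definition multinomial_coef (N : nat) (x : fsseq) : R :=
  (N`!)%:R / \prod_(j <- finsupp x) ((x j)`!)%:R.

End MultivariateSeries.

(** A finite set: x_j <= N for all j, and x_j = 0 for j > m. *)
Definition weighted_types (N m : nat) : set fsseq :=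
  [set x | [/\ (\sum_(j <- finsupp x | 1 <= j) j * x j = m)%N,
               (\sum_(j <- finsupp x | 1 <= j) x j <= N)%N
             & x 0%N = (N - \sum_(j <- finsupp x | 1 <= j) x j)%N]].

(* Main.v *)
Require Import Defs.
From HB Require Import structures.
From mathcomp Require Import all_boot all_order all_algebra finmap.
From mathcomp Require Import all_classical all_reals all_analysis.
From mathcomp Require Import ring.
From mathcomp Require mpoly.
Import -(notations) mpoly.

Set Implicit Arguments.
Unset Strict Implicit.
Unset Printing Implicit Defensive.

Import Order.TTheory GRing.Theory Num.Theory.
Import numFieldNormedType.Exports.

Local Open Scope classical_set_scope.
Local Open Scope ring_scope.

(** Expand (1/N!) (sum_j (v^j/j!) (sum_l w_l Q_j(zeta_l)))^N, with w_0 = 1, by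
    the multinomial theorem in two ways. Over j, the coefficient of
    v^m w^n is the sum over the types x, up to the factor N! m!. Exchanging the
    two inner sums turns the base of the power into sum_l w_l F(zeta_l) with
    F(z) = sum_j Q_j(z) v^j/j! = h(v) e^(z g(v)), and expanding over l gives
    the coefficient prod_l F(zeta_l)^(n_l)/n_l!, where
    prod_l F(zeta_l)^(n_l) = prod_k F(Z_k) = h(v)^N e^(|Z| g(v)).
    Series in v are truncated at v^m, and only the variables w_1, ..., w_K with
    K bounding the support of n are kept. *)

(** * Multinomial theorem *)

Section DividedPowers.
(** [c t] stands for 1/t!, so that the argument also applies in rings without division, such as
    polynomials in w over polynomials in v. *)
Variables (A : comNzRingType) (c : nat -> A).
Hypothesis cE : forall t, c t * (t`!)%:R = 1.

Lemma divided_power_bin t k : (k <= t)%N ->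
  c (t - k)%N * c k = c t * ('C(t, k))%:R.
Proof.
move=> kt; have := congr1 (fun j => j%:R : A) (bin_fact kt); rewrite !natrM => binE.
transitivity (c t * (t`!)%:R * (c (t - k)%N * c k)); first by rewrite cE mul1r.
transitivity ((c k * (k`!)%:R) * (c (t - k)%N * ((t - k)`!)%:R) *
  (c t * ('C(t, k))%:R)); last by rewrite !cE !mul1r.
by rewrite -binE; ring.
Qed.

Variable N : nat.

(** The series exp(a X), cut off after X^N. *)
Definition trunc_exp (a : A) : {poly A} := \poly_(i < N.+1) (c i * a ^+ i).

(** By the binomial theorem exp(a X) exp(b X) = exp((a + b) X), and truncation leaves the degrees up
    to N intact. *)
Lemma coef_prod_trunc_exp (I : Type) (r : seq I) (a : I -> A) t : (t <= N)%N ->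
  (\prod_(i <- r) trunc_exp (a i))`_t = c t * (\sum_(i <- r) a i) ^+ t.
Proof.
elim: r t => [|i r IHr] t tN.
  rewrite !big_nil coef1 expr0n; case: t tN => [|t] _; last by rewrite mulr0.
  by move: (cE 0); rewrite !mulr1 => ->.
rewrite !big_cons coefM exprDn mulr_sumr (reindex_inj rev_ord_inj) /=.
apply: eq_bigr => -[k /= kt] _; rewrite coef_poly subSS subKn//.
rewrite ltnS (leq_trans (leq_subr _ _) tN) IHr; last exact: leq_trans tN.
by rewrite -mulr_natl mulrACA divided_power_bin// -!mulrA.
Qed.

(* The coefficient of t^N in prod_i exp(a_i t) = exp((sum_i a_i) t). *)
Lemma multinomial_theorem (I : finType) (a : I -> A) :
  c N * (\sum_i a i) ^+ N =
  \sum_(x : {ffun I -> 'I_N.+1} | (\sum_i x i)%N == N)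
    \prod_i (c (x i) * a i ^+ x i).
Proof.
rewrite -coef_prod_trunc_exp//.
under eq_bigr do rewrite /trunc_exp poly_def.
(* One exponent [x i] is chosen in each factor; the degree of the resulting term is their sum, so
   the coefficient at [N] selects the sum [N]. *)
rewrite bigA_distr_bigA coef_sum [RHS]big_mkcond; apply: eq_bigr => x _ /=.
under eq_bigr do rewrite -mul_polyC.
rewrite big_split /= -rmorph_prod coefCM prodrXr coefXn eq_sym.
by case: eqP; rewrite ?mulr1 ?mulr0.
Qed.
End DividedPowers.

(** * Series in w_1, w_2, ... and polynomials *)

Definition fsseq_of (K : nat) (f : nat -> nat) : fsseq :=
  [fsfun l in seq_fset tt (iota 0 K) => f l].

Lemma fsseq_ofE K f l : fsseq_of K f l = if (l < K)%N then f l else 0%N.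
Proof. by rewrite fsfun_fun seq_fsetE mem_iota. Qed.

(** Indices outside the support contribute the neutral element. Products over a support thus become
    products over an initial segment, the form in which the multinomial theorem delivers them. *)
Lemma big_finsupp (T : Type) (idx : T) (op : Monoid.com_law idx) K (x : fsseq)
    (P : pred nat) (F : nat -> T) :
  (forall l, x l != 0%N -> (l < K)%N) -> (forall l, x l = 0%N -> F l = idx) ->
  \big[op/idx]_(l <- finsupp x | P l) F l = \big[op/idx]_(l < K | P l) F l.
Proof.
move=> xK F1; rewrite -(big_mkord P) (bigID (fun l => l \in finsupp x)) /=.
rewrite [X in op _ X]big1 ?Monoid.mulm1; last first.
  by move=> l /andP[_]; rewrite mem_finsupp negbK => /eqP/F1.
rewrite [RHS](bigID (fun l => l \in finsupp x)) /=.
rewrite [X in op _ X]big1 ?Monoid.mulm1; last first.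
  by move=> l /andP[_]; rewrite mem_finsupp negbK => /eqP/F1.
under eq_bigl do rewrite andbC; under [RHS]eq_bigl do rewrite andbC.
rewrite -!big_filter_cond; apply: perm_big; apply: uniq_perm.
- exact/filter_uniq/fset_uniq.
- exact/filter_uniq/iota_uniq.
move=> l; rewrite !mem_filter andbb mem_index_iota /= mem_finsupp.
by case: eqP => //= /eqP/xK.
Qed.

(** Turns the finite functions that index the multinomial theorem into types x. *)
Definition ffun_fsseq M N (y : {ffun 'I_M -> 'I_N}) : fsseq :=
  fsseq_of M (fun j => if insub j is Some i then val (y i) else 0%N).

Lemma ffun_fsseqE M N (y : {ffun 'I_M -> 'I_N}) (j : 'I_M) :
  ffun_fsseq y j = y j.
Proof. by rewrite fsseq_ofE ltn_ord valK. Qed.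

Lemma ffun_fsseq_supp M N (y : {ffun 'I_M -> 'I_N}) j :
  ffun_fsseq y j != 0%N -> (j < M)%N.
Proof. by rewrite fsseq_ofE; case: ifP. Qed.

Section Multinomials.
Variable K : nat.

(** As w_0 = 1, position 0 carries the exponent 0 and all other positions are shifted by one. *)
Definition mnm_fsseq (e : multinom K) : fsseq :=
  fsseq_of K.+1 (fun l => if l is j.+1 then nth 0%N e j else 0%N).

Definition fsseq_mnm (x : fsseq) : multinom K :=
  Multinom [tuple x (val i).+1 | i < K].

Lemma mnm_fsseq0 e : mnm_fsseq e 0%N = 0%N.
Proof. by rewrite fsseq_ofE. Qed.

Lemma mnm_fsseqS e (i : 'I_K) : mnm_fsseq e i.+1 = e i.
Proof. by rewrite fsseq_ofE ltnS ltn_ord mnm_tnth (tnth_nth 0%N). Qed.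

Lemma mnm_fsseq_gt e l : (K < l)%N -> mnm_fsseq e l = 0%N.
Proof. by move=> Kl; rewrite fsseq_ofE ltnS leqNgt Kl. Qed.

Lemma fsseq_mnmE (x : fsseq) i : fsseq_mnm x i = x (val i).+1.
Proof. exact: mnmE. Qed.

Lemma fsseq_mnmK (x : fsseq) : x 0%N = 0%N -> (forall l, (K < l)%N -> x l = 0%N) ->
  mnm_fsseq (fsseq_mnm x) = x.
Proof.
move=> x0 xK; apply/fsfunP => -[|l]; first by rewrite mnm_fsseq0.
have [lK|lK] := ltnP l K; last by rewrite mnm_fsseq_gt ?xK.
by rewrite (mnm_fsseqS _ (Ordinal lK)) fsseq_mnmE.
Qed.

Lemma mnm_fsseqK : cancel mnm_fsseq fsseq_mnm.
Proof. by move=> e; apply/mnmP => i; rewrite fsseq_mnmE mnm_fsseqS. Qed.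

Lemma mnm_fsseqD e a b :
  (forall l, mnm_fsseq a l + mnm_fsseq b l = mnm_fsseq e l)%N <->
  e = mnm_add a b.
Proof.
split=> [abe|->]; first by apply/mnmP => i; rewrite mnmDE -!mnm_fsseqS abe.
move=> [|l]; first by rewrite !mnm_fsseq0.
have [lK|lK] := ltnP l K; last by rewrite !mnm_fsseq_gt.
by rewrite !(mnm_fsseqS _ (Ordinal lK)) mnmDE.
Qed.

(** [phi] is to be the embedding of the reals into the polynomials in v. *)
Variables (R : realType) (T : comNzRingType) (phi : {rmorphism R -> T}).

(* The series F and the polynomial P agree on the monomials in w_1, ..., w_K;
   the i-th variable of P, counted from 0, is w_(i+1). *)
Definition represents (F : wseries R) (P : mpoly K T) : Prop :=
  forall e, phi (F (mnm_fsseq e)) = mcoeff e P.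

Lemma represents_one : represents (@ms_one R) 1.
Proof.
move=> e; rewrite mcoeff1 /ms_one rmorph_nat; congr ((nat_of_bool _)%:R).
apply/eqP/eqP => [e0|->].
  by apply/mnmP => i; rewrite mnm0E -mnm_fsseqS e0 fsfun0E.
apply/fsfunP => -[|l]; rewrite fsfun0E ?mnm_fsseq0//.
have [lK|lK] := ltnP l K; last by rewrite mnm_fsseq_gt.
by rewrite (mnm_fsseqS _ (Ordinal lK)) mnm0E.
Qed.

(** If a + b = e, then a and b vanish wherever e does, so the convolution only meets pairs of
    monomials in w_1, ..., w_K. *)
Lemma represents_mul F G P Q :
  represents F P -> represents G Q -> represents (ms_mul F G) (P * Q).
Proof.
move=> FP GQ e; rewrite mcoeffM /ms_mul.
set B := (bmultinom _ _ * bmultinom _ _)%type.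
pose f (k : B) := (mnm_fsseq k.1, mnm_fsseq k.2).
rewrite (fsbigE (map f [seq k : B <- enum {: B} | e == mnm_add k.1 k.2])).
- rewrite big_mkcond big_map big_filter /= rmorph_sum.
  rewrite big_enum_cond; apply: eq_bigr => k /andP[_ /eqP ek].
  rewrite ifT ?rmorphM ?FP ?GQ//.
  by rewrite inE /=; exact/mnm_fsseqD.
- rewrite map_inj_in_uniq ?filter_uniq -?enumT ?enum_uniq//.
  move=> [a b] [a' b'] _ _ [/(can_inj mnm_fsseqK) aa' /(can_inj mnm_fsseqK) bb'].
  by apply/eqP; rewrite xpair_eqE !bmeqP aa' bb' !eqxx.
- move=> ab /= /mapP[k]; rewrite mem_filter => /andP[/eqP ek _] ->.
  exact/mnm_fsseqD.
- move=> [a b] /= abe /negP[]; apply/mapP.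
  have ab0 l : mnm_fsseq e l = 0%N -> a l = 0%N /\ b l = 0%N.
    by rewrite -abe => /eqP; rewrite addn_eq0 => /andP[/eqP -> /eqP].
  have aE : mnm_fsseq (fsseq_mnm a) = a.
    by apply: fsseq_mnmK => [|l lK]; apply ab0; rewrite ?mnm_fsseq0 ?mnm_fsseq_gt.
  have bE : mnm_fsseq (fsseq_mnm b) = b.
    by apply: fsseq_mnmK => [|l lK]; apply ab0; rewrite ?mnm_fsseq0 ?mnm_fsseq_gt.
  have eE : e = mnm_add (fsseq_mnm a) (fsseq_mnm b).
    by apply/mnm_fsseqD; rewrite aE bE.
  (* The sum in [mcoeffM] ranges over monomials of degree at most that of [e]. *)
  have da : (mdeg (fsseq_mnm a) < (mdeg e).+1)%N by rewrite eE mdegD ltnS leq_addr.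
  have db : (mdeg (fsseq_mnm b) < (mdeg e).+1)%N by rewrite eE mdegD ltnS leq_addl.
  exists (BMultinom da, BMultinom db); last by rewrite /f /= aE bE.
  by rewrite mem_filter mem_enum andbT; apply/eqP.
Qed.

Lemma represents_exp F P t :
  represents F P -> represents (ms_exp F t) (P ^+ t).
Proof.
move=> FP; elim: t => [|t IHt]; first exact: represents_one.
by rewrite exprS; exact: represents_mul.
Qed.

Definition mlinear (a : nat -> T) : mpoly K T :=
  mpolyC K (a 0%N) + \sum_(i < K) mpolyC K (a i.+1) * mpolyX T (mnm1 i).

Lemma represents_linear (a : nat -> R) :
  represents (ms_linear a) (mlinear (phi \o a)).
Proof.
move=> e; rewrite /ms_linear rmorphD mcoeffD; congr (_ + _).
  by rewrite rmorphM represents_one mcoeff1 mcoeffC.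
rewrite [RHS]raddf_sum /=.
rewrite (fsbigE [seq i.+1 | i <- index_iota 0 K]).
- rewrite big_map big_mkord rmorph_sum; apply: eq_big => [i|i _]; first by rewrite mem_set.
  rewrite mcoeffCM mcoeffX rmorphM rmorph_nat /=; congr (_ * (nat_of_bool _)%:R).
  apply/eqP/eqP => [eE|<-].
    apply/mnmP => j; rewrite mnm1E -mnm_fsseqS eE fsfun_withE fsfun0E eqSS.
    by rewrite -val_eqE eq_sym; case: eqP.
  apply/fsfunP => -[|l]; rewrite fsfun_withE fsfun0E ?mnm_fsseq0//.
  rewrite eqSS; have [lK|lK] := ltnP l K; last first.
    by rewrite mnm_fsseq_gt// gtn_eqF// (leq_trans (ltn_ord i)).
  by rewrite (mnm_fsseqS _ (Ordinal lK)) mnm1E eq_sym -val_eqE /=; case: eqP.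
- by rewrite map_inj_uniq ?iota_uniq// => ? ? [].
- by move=> l /= /mapP[i _ ->].
(* For l >= K the monomial of [e] does not contain w_(l+1), so the term vanishes. *)
- move=> [|l]//= _; rewrite mem_map => [lK|? ? []//].
  rewrite /ms_var; case: eqP => [eE|_]; last by rewrite mulr0.
  have := congr1 (fun x : fsseq => x l.+1) eE.
  rewrite fsfun_with mnm_fsseq_gt// ltnS leqNgt; apply: contra lK => lK.
  by rewrite mem_index_iota.
Qed.

Lemma represents_prod (I : Type) (r : seq I) (F : I -> wseries R)
    (P : I -> mpoly K T) : (forall i, represents (F i) (P i)) ->
  represents (\big[@ms_mul R/@ms_one R]_(i <- r) F i) (\prod_(i <- r) P i).
Proof.
move=> FP; elim: r => [|i r IHr]; first by rewrite !big_nil; exact: represents_one.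
by rewrite !big_cons; exact: represents_mul.
Qed.

(** The monomial to extract involves only w_1, ..., w_K, so its coefficient can be read off a
    polynomial. *)
Lemma krawtchoukE (u : nat -> nat -> R) (n x : fsseq) :
  (forall l, (K < l)%N -> n l = 0%N) ->
  phi (krawtchouk u n x) =
  mcoeff (fsseq_mnm n) (\prod_(j <- finsupp x) mlinear (phi \o u j) ^+ x j).
Proof.
move=> nK; rewrite /krawtchouk; have <- : mnm_fsseq (fsseq_mnm n) = [fsfun n with 0%N |-> 0%N].
  apply/fsfunP => -[|l]; rewrite fsfun_withE ?mnm_fsseq0//=.
  have [lK|lK] := ltnP l K; last by rewrite mnm_fsseq_gt ?nK.
  by rewrite (mnm_fsseqS _ (Ordinal lK)) fsseq_mnmE.
apply: represents_prod => j; exact/represents_exp/represents_linear.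
Qed.

End Multinomials.

(** * Series in v modulo v^(m+1) *)

Section TruncatedSeries.
Variables (R : realType) (m : nat).
Implicit Types (p q G : {poly R}) (f g h : nat -> R).

Definition eq_trunc p q : Prop := forall i, (i <= m)%N -> p`_i = q`_i.

Lemma eq_trunc_trans q p r : eq_trunc p q -> eq_trunc q r -> eq_trunc p r.
Proof. by move=> pq qr i im; rewrite pq// qr. Qed.

Lemma eq_truncM p p' q q' :
  eq_trunc p p' -> eq_trunc q q' -> eq_trunc (p * q) (p' * q').
Proof.
move=> pp' qq' i im; rewrite !coefM; apply: eq_bigr => -[k /= ki] _.
by rewrite pp' ?qq' ?(leq_trans (leq_subr _ _))// (leq_trans _ im).
Qed.

Lemma eq_trunc_prod (I : Type) (r : seq I) (F G : I -> {poly R}) :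
  (forall i, eq_trunc (F i) (G i)) ->
  eq_trunc (\prod_(i <- r) F i) (\prod_(i <- r) G i).
Proof.
move=> FG; elim: r => [|i r IHr]; first by rewrite !big_nil.
by rewrite !big_cons; exact: eq_truncM.
Qed.

(** v divides G, hence v^t divides G^t. *)
Lemma coef_exp_small G t i : G`_0 = 0 -> (i < t)%N -> (G ^+ t)`_i = 0.
Proof.
move=> G0 it; rewrite -(poly_take_drop 1 G).
have -> : take_poly 1 G = 0.
  by apply/polyP => -[|j]; rewrite coef_take_poly coef0.
by rewrite add0r exprMn -exprM mul1n coefMXn it.
Qed.

(** p - q is a multiple of v^(m+1), so its composition with G is a multiple of G^(m+1), which
    v^(m+1) divides. *)
Lemma eq_trunc_comp p q G : G`_0 = 0 ->
  eq_trunc p q -> eq_trunc (p \Po G) (q \Po G).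
Proof.
move=> G0 pq i im; apply/eqP; rewrite -subr_eq0 -coefB -comp_polyB; apply/eqP.
rewrite -(poly_take_drop m.+1 (p - q)).
have -> : take_poly m.+1 (p - q) = 0.
  apply/polyP => j; rewrite coef_take_poly coef0 coefB ltnS.
  by case: leqP => // /pq ->; rewrite subrr.
rewrite add0r comp_polyM comp_Xn_poly coefM big1// => -[k /= ki] _.
by rewrite coef_exp_small ?mulr0// ltnS (leq_trans (leq_subr _ _)).
Qed.

Definition trunc f : {poly R} := \poly_(i < m.+1) f i.

Lemma coef_trunc f i : (i <= m)%N -> (trunc f)`_i = f i.
Proof. by move=> im; rewrite coef_poly ltnS im. Qed.

Lemma trunc_mul f g : eq_trunc (trunc (ps_mul f g)) (trunc f * trunc g).
Proof.
move=> i im; rewrite coef_trunc// coefM; apply: eq_bigr => -[k /= ki] _.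
by rewrite !coef_trunc// ?(leq_trans (leq_subr _ _))// (leq_trans _ im).
Qed.

Lemma trunc_exp_series f t : eq_trunc (trunc (ps_exp f t)) (trunc f ^+ t).
Proof.
elim: t => [|t IHt]; first by move=> i im; rewrite coef_trunc// coef1.
rewrite exprS; apply: eq_trunc_trans (trunc_mul _ _) _.
exact: eq_truncM.
Qed.

Definition inv_fact (t : nat) : R := (t`!)%:R^-1.

Lemma inv_factE t : inv_fact t * (t`!)%:R = 1.
Proof. by rewrite mulVf// pnatr_eq0 -lt0n fact_gt0. Qed.

Lemma trunc_expz z g : g 0%N = 0 ->
  eq_trunc (trunc (ps_expz z g)) (trunc_exp inv_fact m z \Po trunc g).
Proof.
move=> g0 i im; rewrite coef_trunc// /ps_expz /trunc_exp poly_def.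
rewrite (raddf_sum (comp_poly (trunc g))) coef_sum /=.
(* Both sums are brought to the range k <= m; for k > i the power g^k does not reach v^i. *)
rewrite (big_ord_widen m.+1 (fun k => z ^+ k / (k`!)%:R * ps_exp g k i)) ?ltnS// big_mkcond; apply: eq_bigr => k _ /=.
rewrite comp_polyZ comp_Xn_poly coefZ.
have [ki|ik] := leqP k i.
  by rewrite ltnS ki -trunc_exp_series// coef_trunc// [_ / _]mulrC.
by rewrite ltnS leqNgt ik coef_exp_small ?mulr0 ?coef_trunc.
Qed.

Lemma meixner_trunc (P : nat -> {poly R}) h g z : g 0%N = 0 ->
  meixner_generated P h g ->
  eq_trunc (trunc (fun j => (P j).[z] / (j`!)%:R))
    (trunc h * (trunc_exp inv_fact m z \Po trunc g)).
Proof.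
move=> g0 hP; apply: (@eq_trunc_trans (trunc (ps_mul h (ps_expz z g)))).
  by move=> i im; rewrite !coef_trunc// hP.
apply: eq_trunc_trans (trunc_mul _ _) _; apply: eq_truncM => //.
exact: trunc_expz.
Qed.

(* prod_k h(v) e^(Z_k g(v)) = h(v)^N e^((sum_k Z_k) g(v)) modulo v^(m+1). *)
Lemma meixner_prod (P PN : nat -> {poly R}) h g N (Z : 'I_N -> R) :
  g 0%N = 0 -> meixner_generated P h g ->
  meixner_generated PN (ps_exp h N) g ->
  (\prod_(k < N) trunc (fun j => (P j).[Z k] / (j`!)%:R))`_m =
  (PN m).[ \sum_(k < N) Z k ] / (m`!)%:R.
Proof.
move=> g0 hP hPN.
transitivity ((trunc (fun j => (PN j).[ \sum_(k < N) Z k ] / (j`!)%:R))`_m); last first.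
  by rewrite coef_trunc.
rewrite (meixner_trunc _ g0 hPN)// (eq_trunc_prod _ (fun k => meixner_trunc (Z k) g0 hP))//.
rewrite big_split /= prodr_const card_ord -rmorph_prod; apply: eq_truncM => //.
  by move=> i im; rewrite trunc_exp_series.
(* Substitution of g is multiplicative, so the exponentials are multiplied before g is
   substituted. *)
apply: eq_trunc_comp; first by rewrite coef_trunc.
move=> i im; rewrite (coef_prod_trunc_exp inv_factE)//.
by rewrite coef_poly ltnS im.
Qed.

End TruncatedSeries.

(** * The two expansions *)

Section Expansions.
Variables (R : realType) (K : nat).
Let T : comNzRingType := {poly R}.

Definition inv_factC (t : nat) : mpoly K T := mpolyC K (inv_fact R t)%:P.

Lemma inv_factCE t : inv_factC t * (t`!)%:R = 1.
Proof.
rewrite /inv_factC -(rmorph_nat (@mpolyC K T)) -(rmorph_nat (@polyC R)).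
by rewrite -!rmorphM inv_factE !rmorph1.
Qed.

(** With w_0 = 1 as an extra variable, linear forms become homogeneous and the multinomial theorem
    applies to them uniformly. *)
Definition mvar (l : 'I_K.+1) : mpoly K T :=
  if unlift ord0 l is Some i then mpolyX T (mnm1 i) else 1.

Lemma mlinearE (a : nat -> T) :
  mlinear K a = \sum_(l < K.+1) mpolyC K (a l) * mvar l.
Proof.
rewrite big_ord_recl /mvar unlift_none mulr1; congr (_ + _).
by apply: eq_bigr => i _; rewrite liftK.
Qed.

(** The exchange of the sums over j and l, on which the two expansions rest. *)
Lemma mlinear_sum (I : Type) (r : seq I) (d : I -> T) (a : I -> nat -> T) :
  \sum_(j <- r) mpolyC K (d j) * mlinear K (a j) =
  mlinear K (fun l => \sum_(j <- r) d j * a j l).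
Proof.
rewrite mlinearE; under eq_bigr do rewrite mlinearE mulr_sumr.
rewrite exchange_big; apply: eq_bigr => l _ /=.
rewrite rmorph_sum mulr_suml; apply: eq_bigr => j _.
by rewrite rmorphM mulrA.
Qed.

Lemma prod_mvar (y : 'I_K.+1 -> nat) :
  \prod_l mvar l ^+ y l =
  mpolyX T (Multinom [tuple y (lift ord0 i) | i < K]).
Proof.
rewrite big_ord_recl {1}/mvar unlift_none expr1n mul1r mpolyXE_id.
by apply: eq_bigr => i _; rewrite /mvar liftK mnmE.
Qed.

(** Expansion over l: of all exponent vectors of total N, only n itself produces the monomial of
    n. *)
Lemma mcoeff_mlinear_exp (a : nat -> T) (n : fsseq) N :
  (\sum_(l < K.+1) n l)%N = N ->
  mcoeff (fsseq_mnm K n) (inv_factC N * mlinear K a ^+ N) =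
  \prod_(l < K.+1) ((inv_fact R (n l))%:P * a l ^+ n l).
Proof.
move=> nN; rewrite mlinearE (multinomial_theorem inv_factCE) raddf_sum /=.
have termE (y : {ffun 'I_K.+1 -> 'I_N.+1}) :
    mcoeff (fsseq_mnm K n)
      (\prod_l (inv_factC (y l) * (mpolyC K (a l) * mvar l) ^+ y l)) =
    (\prod_l ((inv_fact R (y l))%:P * a l ^+ y l)) *
      (Multinom [tuple (y (lift ord0 i) : nat) | i < K] == fsseq_mnm K n)%:R.
  under eq_bigr do rewrite exprMn mulrA.
  rewrite big_split /= (prod_mvar (fun l => y l)) -mcoeffX -mcoeffCM rmorph_prod.
  by under [in RHS]eq_bigr do rewrite rmorphM rmorphXn.
under eq_bigr do rewrite termE.
have n_lt (l : 'I_K.+1) : (n l < N.+1)%N.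
  by rewrite ltnS -nN (bigD1 l)//= leq_addr.
pose y0 : {ffun 'I_K.+1 -> 'I_N.+1} := [ffun l : 'I_K.+1 => inord (n l)].
have y0E l : y0 l = n l :> nat by rewrite ffunE inordK.
rewrite (bigD1 y0) /=; last by under eq_bigr do rewrite y0E; rewrite nN.
rewrite [X in _ + X]big1 => [|y /andP[/eqP yN yy0]]; last first.
  case: eqP => [yn|]; last by rewrite mulr0.
  case/eqP: yy0; apply/ffunP => l; apply: val_inj; rewrite /= y0E.
  have yS i : y (lift ord0 i) = n (lift ord0 i) :> nat.
    by have /mnmP/(_ i) := yn; rewrite mnmE fsseq_mnmE.
  have [i ->|->] := unliftP ord0 l; first exact: yS.
  (* The monomial does not show the exponent of w_0 = 1; the common total [N] determines it. *)
  move: (etrans yN (esym nN)); rewrite !big_ord_recl.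
  by under eq_bigr do rewrite yS; move/addIn.
rewrite addr0; under eq_bigr do rewrite y0E.
rewrite (_ : Multinom _ == _) ?mulr1//; apply/eqP/mnmP => i.
by rewrite mnmE fsseq_mnmE y0E.
Qed.

(** Expansion over j: each term contains a product of powers of linear forms, whose coefficient at
    w^n is a [krawtchouk] value. *)
Lemma mcoeff_sum_mlinear_exp (u : nat -> nat -> R) (d : nat -> T) (n : fsseq) M N :
  (forall l, (K < l)%N -> n l = 0%N) ->
  mcoeff (fsseq_mnm K n)
    (inv_factC N *
     (\sum_(j < M) mpolyC K (d j) * mlinear K (@polyC R \o u j)) ^+ N) =
  \sum_(y : {ffun 'I_M -> 'I_N.+1} | (\sum_j y j)%N == N)
    (\prod_j ((inv_fact R (y j))%:P * d j ^+ y j)) *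
    (krawtchouk u n (ffun_fsseq y))%:P.
Proof.
move=> nK; rewrite (multinomial_theorem inv_factCE) raddf_sum /=.
apply: eq_bigr => y _.
under eq_bigr do rewrite exprMn mulrA.
rewrite big_split /=.
rewrite (krawtchoukE (@polyC R) _ _ nK).
rewrite (big_finsupp _ _ (@ffun_fsseq_supp _ _ y)) => [|l ->]; last by rewrite expr0.
rewrite -mcoeffCM rmorph_prod; congr (mcoeff _ (_ * _)).
  by apply: eq_bigr => j _; rewrite rmorphM rmorphXn.
by apply: eq_bigr => j _; rewrite ffun_fsseqE.
Qed.

End Expansions.

(** * Types of size N and weight m as finite functions *)

Lemma leq_weight (x : fsseq) (a : nat -> nat) j : (1 <= j)%N ->
  (a j * x j <= \sum_(i <- finsupp x | 1 <= i) a i * x i)%N.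
Proof.
move=> j1; have [jx|] := boolP (j \in finsupp x); last first.
  by rewrite mem_finsupp negbK => /eqP ->; rewrite muln0.
by rewrite (big_rem j jx) j1 leq_addr.
Qed.

(** If x_j >= 1 and j >= 1, then j <= j x_j <= m. *)
Lemma weighted_types_supp N m x j : weighted_types N m x -> x j != 0%N ->
  (j < m.+1)%N.
Proof.
case: j => // j [xm _ _]; rewrite -lt0n ltnS => xj.
by rewrite -xm (leq_trans _ (leq_weight x id (ltn0Sn j)))// leq_pmulr.
Qed.

Lemma weighted_typesE N m (x : fsseq) : (forall j, x j != 0%N -> (j < m.+1)%N) ->
  weighted_types N m x <->
  (\sum_(j < m.+1) x j = N)%N /\ (\sum_(j < m.+1) j * x j = m)%N.
Proof.
move=> xm; rewrite /weighted_types /=.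
rewrite (big_finsupp _ _ xm) => [|j ->]; last by rewrite muln0.
rewrite (big_finsupp _ _ xm)//.
have posE (F : nat -> nat) : (\sum_(j < m.+1 | 0 < j) F j = \sum_(j < m) F j.+1)%N.
  by rewrite big_mkcond big_ord_recl /= add0n.
rewrite (posE (fun j => j * x j)%N) (posE x) !big_ord_recl mul0n add0n.
(* The bound [xN] makes the truncated subtraction defining x_0 exact. *)
split=> [[mE xN x0]|[NE mE]]; split => //; first by rewrite x0 subnK.
  by rewrite -NE leq_addl.
by rewrite -NE addnK.
Qed.

Lemma ffun_fsseq_inj M N : injective (@ffun_fsseq M N).
Proof.
move=> y y' yy'; apply/ffunP => j; apply: val_inj => /=.
by rewrite -!ffun_fsseqE yy'.
Qed.

(** Every entry of a type is at most N and its support lies in {0, ..., m}, so each type comes from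
    exactly one finite function. *)
Lemma fsbig_weighted_types (R : realType) N m (F : fsseq -> R) :
  \sum_(x \in weighted_types N m) F x =
  \sum_(y : {ffun 'I_m.+1 -> 'I_N.+1} |
      ((\sum_j y j)%N == N) && ((\sum_(j < m.+1) j * y j)%N == m))
    F (ffun_fsseq y).
Proof.
have typeE (y : {ffun 'I_m.+1 -> 'I_N.+1}) :
    weighted_types N m (ffun_fsseq y) <->
    ((\sum_j y j)%N == N) && ((\sum_(j < m.+1) j * y j)%N == m).
  rewrite weighted_typesE; last exact: ffun_fsseq_supp.
  have -> : (\sum_(j < m.+1) ffun_fsseq y j = \sum_j y j)%N.
    by apply: eq_bigr => j _; rewrite ffun_fsseqE.
  have -> : (\sum_(j < m.+1) j * ffun_fsseq y j = \sum_(j < m.+1) j * y j)%N.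
    by apply: eq_bigr => j _; rewrite ffun_fsseqE.
  by split=> [[-> ->]|/andP[/eqP -> /eqP ->]]; rewrite ?eqxx.
pose I := {ffun 'I_m.+1 -> 'I_N.+1}; pose r := [seq y : I <- enum {: I} |
  ((\sum_j y j)%N == N) && ((\sum_(j < m.+1) j * y j)%N == m)].
rewrite (fsbigE (map (@ffun_fsseq _ _) r)).
- rewrite big_mkcond big_map big_filter big_enum_cond.
  by apply: eq_bigr => y /andP[_ ry]; rewrite ifT// inE; exact/typeE.
- by rewrite (map_inj_uniq (@ffun_fsseq_inj _ _)) filter_uniq ?enum_uniq.
- by move=> x /= /mapP[y]; rewrite mem_filter => /andP[ry _] ->; exact/typeE.
move=> x xNm /negP[]; apply/mapP.
have xm j := weighted_types_supp (j := j) xNm.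
have [xN _] := (weighted_typesE N xm).1 xNm.
have xjN (j : 'I_m.+1) : (x j < N.+1)%N.
  by rewrite ltnS -xN (bigD1 j)//= leq_addr.
pose y : {ffun 'I_m.+1 -> 'I_N.+1} := [ffun j : 'I_m.+1 => inord (x j)].
have xy : x = ffun_fsseq y.
  apply/fsfunP => j; have [jm|jm] := ltnP j m.+1.
    by rewrite (ffun_fsseqE y (Ordinal jm)) ffunE inordK.
  rewrite [RHS]fsseq_ofE ltnNge jm /=; apply/eqP; apply: contraLR jm => /xm.
  by rewrite -ltnNge.
by exists y; rewrite // mem_filter mem_enum andbT; apply/typeE; rewrite -xy.
Qed.

Lemma multinomial_coefE (R : realType) N K (x : fsseq) :
  (forall l, x l != 0%N -> (l < K)%N) ->
  multinomial_coef R N x = (N`!)%:R * \prod_(l < K) inv_fact R (x l).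
Proof.
move=> xK; rewrite /multinomial_coef (big_finsupp _ _ xK) => [|l ->//].
by rewrite prodfV.
Qed.

(** * Comparison of the coefficients of v^m w^n in the two expansions *)

Theorem theorem11 (R : realType) (lambda mu : nat -> R)
    (p : R -> nat -> nat -> R) (Q : nat -> {poly R})
    (psi : probability (measurableTypeR R) R) (zeta : nat -> R)
    (h g : nat -> R)
    (hrates : birth_death_rates lambda mu)
    (hp : nonexplosive_bd_transition lambda mu p)
    (hQ : spectral_polys lambda mu Q)
    (hpsi : spectral_measure lambda mu p Q psi)
    (hzeta : discrete_spectrum psi zeta)
    (hh0 : h 0%N = 1) (hg0 : g 0%N = 0) (hg1 : g 1%N != 0)
    (hmeixner : meixner_generated Q h g)
    (N : nat) (hN : (1 <= N)%N)
    (QN : nat -> {poly R}) (hQN : meixner_generated QN (ps_exp h N) g)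
    (Z : 'I_N -> R) (hZ : forall k, exists l, Z k = zeta l)
    (n : fsseq) (hn : forall l, n l = #|[set k | Z k == zeta l]%SET|)
    (m : nat) :
  (multinomial_coef R N n)^-1 *
    (\sum_(x \in weighted_types N m)
       multinomial_coef R N x *
       ((m`!)%:R / \prod_(j <- finsupp x | (1 <= j)%N) ((j`!)%:R ^+ x j)) *
       krawtchouk (fun j l => (Q j).[zeta l]) n x)
  = (QN m).[ \sum_(k < N) Z k ].
Proof.
have [zeta_inj _ _ _] := hzeta.
(* [K] is the largest l for which zeta_l occurs among the Z_k. *)
have [K nK] : exists K, forall l, n l != 0%N -> (l < K.+1)%N.
  exists (\max_(l <- finsupp n) l)%N => l nl.
  by rewrite ltnS (@leq_bigmax_seq _ _ xpredT id) ?mem_finsupp.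
have n0 l : (K < l)%N -> n l = 0%N.
  by move=> Kl; apply/eqP; apply: contraLR Kl => /nK; rewrite ltnS -leqNgt.
have [L ZL] : {L : 'I_N -> 'I_K.+1 & forall k, Z k = zeta (L k)}.
  apply: (@choice _ _ (fun k l => Z k = zeta (val l))) => k.
  have [l Zl] := hZ k.
  have nl : n l != 0%N.
    by rewrite hn -lt0n; apply/card_gt0P; exists k; rewrite inE Zl.
  by exists (Ordinal (nK _ nl)).
have nL (l : 'I_K.+1) : n l = #|[pred k | L k == l]|.
  rewrite hn; apply: eq_card => k; rewrite !inE ZL.
  by rewrite (inj_eq zeta_inj).
have sum_n : (\sum_(l < K.+1) n l)%N = N.
  rewrite -[RHS]card_ord -sum1_card (partition_big L xpredT)//=.
  by apply: eq_bigr => l _; rewrite nL sum1_card.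
pose u j l := (Q j).[zeta l].
pose F z := trunc m (fun j => (Q j).[z] / (j`!)%:R).
(* The factors are grouped by the label [L k]; the label l occurs n_l times. *)
have prodF : \prod_(l < K.+1) F (zeta l) ^+ n l = \prod_(k < N) F (Z k).
  rewrite (partition_big L xpredT)//=; apply: eq_bigr => l _.
  under eq_bigr => k /eqP kl do rewrite ZL kl.
  by rewrite prodr_const nL.
(* The real factor of the term of type x when d_j = v^j/j!. *)
pose w (x : nat -> nat) : R :=
  \prod_(j < m.+1) (inv_fact R (x j) * inv_fact R j ^+ x j).
have main : \sum_(y : {ffun 'I_m.+1 -> 'I_N.+1} |
      ((\sum_j y j)%N == N) && ((\sum_(j < m.+1) j * y j)%N == m))
    w (ffun_fsseq y) * krawtchouk u n (ffun_fsseq y) =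
  \prod_(l < K.+1) inv_fact R (n l) * ((QN m).[ \sum_(k < N) Z k ] / (m`!)%:R).
  (* Taking d_j = v^j/j! makes [F (zeta l)] the coefficient of w_l in the base of the power. *)
  have := @mcoeff_sum_mlinear_exp R K u (fun j => inv_fact R j *: 'X^j) n m.+1 N n0.
  rewrite mlinear_sum mcoeff_mlinear_exp//.
  under [in LHS]eq_bigr => l _.
    have -> : \sum_(j < m.+1) (inv_fact R j *: 'X^j) * (@polyC R \o u j) l =
        F (zeta l).
      rewrite /F /trunc poly_def; apply: eq_bigr => j _ /=.
      by rewrite mulrC mul_polyC scalerA.
    over.
  rewrite big_split /= -rmorph_prod prodF => /(congr1 (coefp m)) /=.
  rewrite mul_polyC coefZ (meixner_prod _ _ hg0 hmeixner hQN) => ->.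
  rewrite coef_sum big_mkcondr /=; apply: eq_bigr => y _.
  (* The term of [y] has v-degree equal to the sum of the j y_j, so extracting v^m imposes the
     weight condition. *)
  have -> : \prod_j ((inv_fact R (y j))%:P * (inv_fact R j *: 'X^j) ^+ y j) =
      w (ffun_fsseq y) *: 'X^(\sum_(j < m.+1) j * y j).
    under eq_bigr do rewrite exprZn -exprM -mul_polyC mulrA -polyCM.
    rewrite big_split /= -rmorph_prod mul_polyC prodrXr; congr (_ *: _).
    by apply: eq_bigr => j _; rewrite ffun_fsseqE.
  rewrite coefMC coefZ coefXn eq_sym.
  by case: eqP => _; rewrite ?mulr1 ?mulr0 ?mul0r.
have fact_neq0 t : (t`!)%:R != 0 :> R by rewrite pnatr_eq0 -lt0n fact_gt0.
rewrite fsbig_weighted_types.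
under eq_bigr => y _.
  have -> : multinomial_coef R N (ffun_fsseq y) *
      ((m`!)%:R / \prod_(j <- finsupp (ffun_fsseq y) | (1 <= j)%N)
                    (j`!)%:R ^+ ffun_fsseq y j) =
      (N`!)%:R * (m`!)%:R * w (ffun_fsseq y).
    have ym := @ffun_fsseq_supp _ _ y.
    rewrite (multinomial_coefE R N ym) (big_finsupp _ _ ym) => [|j ->//].
    rewrite -prodfV /w big_split /= mulrACA; congr (_ * (_ * _)).
    (* The factor for j = 0 is a power of 1/0! = 1, so the products over j >= 1 and over j >= 0
       agree. *)
    rewrite [LHS]big_mkcond; apply: eq_bigr => -[[|j] jm] _ /=; first by rewrite /inv_fact invr1 expr1n.
    by rewrite -exprVn.
  rewrite -mulrA; over.
(* The factor N! m! cancels against the multinomial coefficient of n and the 1/m! in [main]. *)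
rewrite -mulr_sumr main (multinomial_coefE R N nK).
have P0 : \prod_(l < K.+1) inv_fact R (n l) != 0.
  by apply/prodf_neq0 => l _; rewrite invr_eq0.
by field; rewrite P0 !fact_neq0.
Qed.
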